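(* There exists an algorithm which, given a positive integer $N$, determines whether there exist palindromic numbers $A, B$ with $N = A/B$, and which runs in time $O(N^{9/2})$.
   Context: A positive integer $n$ is palindromic if its binary representation (most significant digit first, no leading zeros) reads the same forwards and backwards. *)

(* Defs.v *)
From Stdlib Require Import Arith List.
Import ListNotations.

(* Binary digits of n, least significant first (no leading zeros:
   bits 0 = [], and for n > 0 the last entry is the leading 1). The fuel n
   suffices since n halves at each step. *)
Fixpoint bits_aux (fuel n : nat) : list bool :=
  match fuel with
  | 0 => []
  | S f => if Nat.eqb n 0 then [] else Nat.odd n :: bits_aux f (Nat.div2 n)
  end.

Definition binary_repr (n : nat) : list bool := rev (bits_aux n n).

Definition palindromic (n : nat) : Prop :=
  0 < n /\ rev (binary_repr n) = binary_repr n.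

Definition palindromic_quotient (N : nat) : Prop :=
  exists A B : nat, palindromic A /\ palindromic B /\ A = N * B.

(* Memory: infinitely many registers indexed by nat, holding naturals.
   Each instruction costs one time step. Arithmetic: addition, truncated
   subtraction, halving; comparison jumps; indirect addressing. *)
Inductive instr : Type :=
| Const  (d c : nat)
| Add    (d a b : nat)
| Sub    (d a b : nat)
| Half   (d a : nat)
| LoadInd  (d a : nat)
| StoreInd (a s : nat)
| JumpLt (a b target : nat)
| Halt   (r : nat).

Definition program := list instr.
Definition memory := nat -> nat.
Definition conf : Type := (nat * memory)%type.

Definition upd (m : memory) (k v : nat) : memory :=
  fun i => if Nat.eqb i k then v else m i.

Inductive outcome : Type :=
| Next (c : conf)
| Done (b : bool)
| Stuck.

Definition step (p : program) (c : conf) : outcome :=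
  let (pc, m) := c in
  match nth_error p pc with
  | None => Stuck
  | Some i =>
    match i with
    | Const d k => Next (S pc, upd m d k)
    | Add d a b => Next (S pc, upd m d (m a + m b))
    | Sub d a b => Next (S pc, upd m d (m a - m b))
    | Half d a => Next (S pc, upd m d (Nat.div2 (m a)))
    | LoadInd d a => Next (S pc, upd m d (m (m a)))
    | StoreInd a s => Next (S pc, upd m (m a) (m s))
    | JumpLt a b t => if Nat.ltb (m a) (m b) then Next (t, m) else Next (S pc, m)
    | Halt r => Done (negb (Nat.eqb (m r) 0))
    end
  end.

Fixpoint run (p : program) (t : nat) (c : conf) : option bool :=
  match t with
  | 0 => None
  | S t' =>
    match step p c with
    | Next c' => run p t' c'
    | Done b => Some b
    | Stuck => None
    end
  end.

Definition init (N : nat) : conf := (0, fun i => if Nat.eqb i 0 then N else 0).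

(* Main.v *)
Require Import Defs.
From Stdlib Require Import Arith List Lia Bool.
(* Defs again: List declares another [Add]. *)
Import ListNotations Defs.

(** N is a quotient of palindromes iff it is odd and, for some P = 2^k, there
    are odd X, Y < 2^j with X = N Y and P X' = N Y', where ' reverses j-digit
    words.  Indeed, for palindromes A = N B with k = |A| - |B|, the words
    X = A and Y = 0^k B (most significant digit first) with j = |A| work;
    conversely A = X' 0^k X and B = Y' Y are palindromes with A = N B.
    Reading the digits of Y from the low end, both conditions are tracked by a
    finite graph: c < N is the carry of the product N Y, and g measures how far
    the high ends of P X' and N Y' are apart.  A solution is a walk from (0, P)
    back to (0, P) whose first digit is 1.  A walk that returns keeps g < N + P,
    and P < 2N is forced, so 3N^2 states suffice for each of O(log N) values of
    P.  Saturating this graph in 3N^2 rounds costs O(N^4) steps per P, hence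
    O(N^4 log N) in all. *)

(** * Binary words, their values, and palindromes *)

Fixpoint lsb_val (l : list bool) : nat :=
  match l with
  | [] => 0
  | b :: l' => Nat.b2n b + 2 * lsb_val l'
  end.

Definition msb_val (l : list bool) : nat := lsb_val (rev l).

Lemma lsb_val_app (l l' : list bool) :
  lsb_val (l ++ l') = lsb_val l + 2 ^ length l * lsb_val l'.
Proof.
  induction l as [|b l IH]; cbn [lsb_val app length]; [simpl; lia|].
  rewrite IH, Nat.pow_succ_r'. lia.
Qed.

Lemma lsb_val_lt (l : list bool) : lsb_val l < 2 ^ length l.
Proof.
  induction l as [|b l IH]; cbn [lsb_val length]; [simpl; lia|].
  rewrite Nat.pow_succ_r'. destruct b; simpl Nat.b2n; lia.
Qed.

Lemma lsb_val_repeat_false (k : nat) : lsb_val (repeat false k) = 0.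
Proof. induction k as [|k IH]; cbn [lsb_val repeat]; [|rewrite IH]; reflexivity. Qed.

Lemma lsb_val_inj (l l' : list bool) :
  length l = length l' -> lsb_val l = lsb_val l' -> l = l'.
Proof.
  revert l'; induction l as [|b l IH]; intros [|b' l'] Hlen Hval;
    cbn [length lsb_val] in *; try discriminate; [reflexivity|].
  assert (b = b') by (destruct b, b'; simpl Nat.b2n in *; lia).
  subst b'. f_equal. apply IH; lia.
Qed.

Lemma msb_val_cons (b : bool) (l : list bool) :
  msb_val (b :: l) = Nat.b2n b * 2 ^ length l + msb_val l.
Proof.
  unfold msb_val. cbn [rev]. rewrite lsb_val_app, length_rev. cbn [lsb_val]. lia.
Qed.

Lemma msb_val_lt (l : list bool) : msb_val l < 2 ^ length l.
Proof. unfold msb_val. rewrite <- length_rev. apply lsb_val_lt. Qed.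

Lemma lsb_val_bits_aux (fuel n : nat) : n <= fuel -> lsb_val (bits_aux fuel n) = n.
Proof.
  revert n; induction fuel as [|fuel IH]; intros n Hn; cbn [bits_aux]; [simpl; lia|].
  destruct (Nat.eqb_spec n 0) as [->|Hn0]; [reflexivity|].
  pose proof (Nat.div2_odd n). cbn [lsb_val]. rewrite IH; lia.
Qed.

Lemma bits_aux_snoc_true (fuel n : nat) :
  0 < n <= fuel -> exists l, bits_aux fuel n = l ++ [true].
Proof.
  revert n; induction fuel as [|fuel IH]; intros n Hn; [lia|]. cbn [bits_aux].
  destruct (Nat.eqb_spec n 0) as [->|_]; [lia|].
  destruct (Nat.eq_dec (Nat.div2 n) 0) as [H0|H0].
  - assert (n = 1) as ->.
    { pose proof (Nat.div2_odd n) as Hn2. rewrite H0 in Hn2.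
      destruct (Nat.odd n); simpl in Hn2; lia. }
    exists []. destruct fuel; reflexivity.
  - destruct (IH (Nat.div2 n)) as [l ->].
    + split; [now apply Nat.neq_0_lt_0|apply Nat.div2_decr; lia].
    + now exists (Nat.odd n :: l).
Qed.

Lemma bits_aux_lsb_val (fuel : nat) (l : list bool) :
  lsb_val (l ++ [true]) <= fuel -> bits_aux fuel (lsb_val (l ++ [true])) = l ++ [true].
Proof.
  revert fuel; induction l as [|b l IH]; intros fuel Hf.
  - simpl in *. destruct fuel as [|[|fuel]]; [lia| |]; reflexivity.
  - cbn [app lsb_val] in *.
    assert (Hpos : 0 < lsb_val (l ++ [true])).
    { rewrite lsb_val_app. cbn [lsb_val Nat.b2n].
      pose proof (Nat.pow_nonzero 2 (length l)). lia. }
    destruct fuel as [|fuel]; [lia|]. cbn [bits_aux].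
    destruct (Nat.eqb_spec (Nat.b2n b + 2 * lsb_val (l ++ [true])) 0); [lia|].
    replace (Nat.odd (Nat.b2n b + 2 * lsb_val (l ++ [true]))) with b
      by (rewrite Nat.odd_add_mul_2; now destruct b).
    now rewrite Nat.div2_div, Nat.add_b2n_double_div2, IH by (destruct b; simpl in *; lia).
Qed.

Definition bits (n : nat) : list bool := bits_aux n n.

Lemma palindromic_bits (n : nat) : palindromic n <-> 0 < n /\ rev (bits n) = bits n.
Proof.
  unfold palindromic, binary_repr. fold (bits n). rewrite rev_involutive.
  split; intros [H E]; split; auto.
Qed.

(** A symmetric word that starts with 1 also ends with 1, so it has no leading zeros and is the
    digit word of its value. *)
Lemma palindromic_lsb_val (l : list bool) :
  rev (true :: l) = true :: l -> palindromic (lsb_val (true :: l)).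
Proof.
  intros E. apply palindromic_bits. split; [cbn [lsb_val Nat.b2n]; lia|].
  unfold bits. rewrite <- E. cbn [rev]. rewrite bits_aux_lsb_val by reflexivity.
  change (rev l ++ [true]) with (rev (true :: l)). now rewrite E, E.
Qed.

Lemma palindromic_bits_cons (n : nat) :
  palindromic n -> exists l, bits n = true :: l.
Proof.
  intros [Hn E]%palindromic_bits.
  destruct (bits_aux_snoc_true n n) as [l Hl]; [lia|].
  exists (rev l). rewrite <- E. unfold bits. rewrite Hl. now rewrite rev_app_distr.
Qed.

(** * The carry graph *)

Section Transitions.

Variables N P : nat.

(* The digit of X is [Nat.odd s].  Exactly, g - P doubles and gains P times the
   digit of X minus N times the digit b of Y.  Truncation is harmless: a walk
   whose exact value drops to 0 or below can never return to P > 0, and the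
   truncated value 0 is absorbing. *)
Definition next (b : bool) (x : nat * nat) : nat * nat :=
  let s := fst x + Nat.b2n b * N in
  (Nat.div2 s, 2 * snd x - Nat.b2n b * N - (if Nat.odd s then 0 else P)).

Definition consume (x : nat * nat) (l : list bool) : nat * nat :=
  fold_left (fun y b => next b y) l x.

(** The digits of X that schoolbook multiplication emits while it reads Y; its carry evolves as the
    first component of [consume]. *)
Fixpoint product_bits (c : nat) (l : list bool) : list bool :=
  match l with
  | [] => []
  | b :: l' =>
      let s := c + Nat.b2n b * N in Nat.odd s :: product_bits (Nat.div2 s) l'
  end.

Lemma length_product_bits (c : nat) (l : list bool) : length (product_bits c l) = length l.
Proof. revert c; induction l as [|b l IH]; intros c; cbn; auto. Qed.

Lemma consume_low (l : list bool) (c g : nat) :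
  c + N * lsb_val l =
  lsb_val (product_bits c l) + 2 ^ length l * fst (consume (c, g) l).
Proof.
  revert c g; induction l as [|b l IH]; intros c g; [simpl; lia|].
  cbn [product_bits lsb_val length consume fold_left].
  pose proof (Nat.div2_odd (c + Nat.b2n b * N)) as Hs.
  unfold next at 2. cbn [fst snd].
  match goal with |- context [fold_left _ l (?c', ?g')] => specialize (IH c' g') end.
  unfold consume in IH. rewrite Nat.pow_succ_r'. lia.
Qed.

(* The exact equation under which reading l leads from g to gf, written without
   subtraction. *)
Definition balanced (c g : nat) (l : list bool) (gf : nat) : Prop :=
  2 ^ length l * g + P * msb_val (product_bits c l) + P =
  gf + P * 2 ^ length l + N * msb_val l.

Lemma balanced_cons (b : bool) (l : list bool) (c g gf : nat) :
  let s := c + Nat.b2n b * N in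
  balanced c g (b :: l) gf <->
  2 ^ length l * (2 * g) + P * msb_val (product_bits (Nat.div2 s) l) + P =
  gf + 2 ^ length l * ((if Nat.odd s then 0 else P) + Nat.b2n b * N)
  + P * 2 ^ length l + N * msb_val l.
Proof.
  intros s. unfold balanced. cbn [product_bits length]. fold s.
  rewrite !msb_val_cons, length_product_bits, Nat.pow_succ_r'.
  destruct (Nat.odd s), b; simpl Nat.b2n; split; lia.
Qed.

Lemma balanced_next (b : bool) (l : list bool) (c g gf : nat) :
  0 < gf -> balanced c g (b :: l) gf ->
  balanced (fst (next b (c, g))) (snd (next b (c, g))) l gf.
Proof.
  intros Hgf H. apply balanced_cons in H. unfold balanced, next. cbn [fst snd].
  set (s := c + Nat.b2n b * N) in *.
  set (d := if Nat.odd s then 0 else P) in *.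
  pose proof (msb_val_lt (product_bits (Nat.div2 s) l)) as HR.
  rewrite length_product_bits in HR.
  set (R := msb_val (product_bits (Nat.div2 s) l)) in *.
  set (q := 2 ^ length l) in *.
  assert (Hle : d + Nat.b2n b * N <= 2 * g).
  { destruct (Nat.le_gt_cases (d + Nat.b2n b * N) (2 * g)) as [?|Hlt]; [assumption|]. nia. }
  replace (2 * g - Nat.b2n b * N - d) with (2 * g - (d + Nat.b2n b * N)) by lia.
  rewrite Nat.mul_sub_distr_l.
  assert (q * (d + Nat.b2n b * N) <= q * (2 * g)) by (apply Nat.mul_le_mono_l; assumption).
  lia.
Qed.

(** The unread digits of Y subtract less than N * 2^(length l), too little to bring g back to P from
    N + P or above. *)
Lemma balanced_bound (l : list bool) (c g : nat) :
  0 < N -> balanced c g l P -> g < N + P.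
Proof.
  intros HN H. unfold balanced in H. pose proof (msb_val_lt l) as Hl.
  set (q := 2 ^ length l) in *.
  destruct (Nat.lt_ge_cases g (N + P)) as [?|Hge]; [assumption|]. nia.
Qed.

Lemma consume_zero (l : list bool) (c : nat) : snd (consume (c, 0) l) = 0.
Proof. revert c; induction l as [|b l IH]; intros c; [reflexivity|apply IH]. Qed.

(** A truncated value 0 would be absorbing, so a positive final value shows that every subtraction
    on the way was exact. *)
Lemma consume_balanced (l : list bool) (c g : nat) :
  0 < snd (consume (c, g) l) -> balanced c g l (snd (consume (c, g) l)).
Proof.
  revert c g; induction l as [|b l IH]; intros c g Hpos.
  - unfold balanced, msb_val. simpl. lia.
  - apply balanced_cons. change (consume (c, g) (b :: l)) with (consume (next b (c, g)) l) in *.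
    unfold next in *. cbn [fst snd] in *.
    set (s := c + Nat.b2n b * N) in *.
    set (d := if Nat.odd s then 0 else P) in *.
    specialize (IH _ _ Hpos). unfold balanced in IH.
    assert (2 * g - Nat.b2n b * N - d <> 0).
    { intros H0. rewrite H0, consume_zero in Hpos. lia. }
    replace (2 * g - Nat.b2n b * N - d) with (2 * g - (d + Nat.b2n b * N)) in IH at 1 by lia.
    rewrite Nat.mul_sub_distr_l in IH.
    assert (2 ^ length l * (d + Nat.b2n b * N) <= 2 ^ length l * (2 * g))
      by (apply Nat.mul_le_mono_l; lia).
    lia.
Qed.

Lemma balanced_consume (l : list bool) (c g gf : nat) :
  0 < gf -> balanced c g l gf -> snd (consume (c, g) l) = gf.
Proof.
  revert c g; induction l as [|b l IH]; intros c g Hgf H.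
  - unfold balanced, msb_val in H. simpl in *. lia.
  - apply balanced_next in H; [|assumption].
    change (consume (c, g) (b :: l)) with (consume (next b (c, g)) l).
    rewrite (surjective_pairing (next b (c, g))). now apply IH.
Qed.

(** Walks with n edges; the cap W on the second component makes the graph finite. *)
Inductive reachable (W : nat) (x0 : nat * nat) : nat -> nat * nat -> Prop :=
| reachable_start : snd x0 < W -> reachable W x0 0 x0
| reachable_next n x b : reachable W x0 n x -> snd (next b x) < W ->
    reachable W x0 (S n) (next b x).

Lemma reachable_consume (W n : nat) (x0 x : nat * nat) :
  reachable W x0 n x -> exists l, x = consume x0 l.
Proof.
  induction 1 as [|n x b _ [l ->] _]; [now exists []|].
  exists (l ++ [b]). unfold consume. now rewrite fold_left_app.
Qed.

(** Every state on the way is balanced for the rest of the word, hence stays below N + P and under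
    the cap. *)
Lemma balanced_reachable (W : nat) (x0 : nat * nat) (l : list bool) (n : nat) (x : nat * nat) :
  0 < N -> 0 < P -> N + P <= W -> reachable W x0 n x ->
  balanced (fst x) (snd x) l P -> exists n', reachable W x0 n' (consume x l).
Proof.
  intros HN HP HW. revert n x; induction l as [|b l IH]; intros n [c g] Hr Hb; [now exists n|].
  apply balanced_next in Hb; [|assumption].
  apply (IH (S n) (next b (c, g))); [|assumption].
  apply reachable_next; [assumption|].
  apply balanced_bound in Hb; [eapply Nat.lt_le_trans; eassumption|assumption].
Qed.

End Transitions.

(** * Closed walks and palindromic quotients *)

(** The walk starts after the forced first digit 1. The cap 3N suffices because P < 2N. *)
Definition loops (N k : nat) : Prop :=
  exists n, reachable N (2 ^ k) (3 * N) (next N (2 ^ k) true (0, 2 ^ k)) n (0, 2 ^ k).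

Lemma loops_palindromic_quotient (N k : nat) :
  Nat.odd N = true -> loops N k -> palindromic_quotient N.
Proof.
  intros Hodd [n Hr]. apply reachable_consume in Hr. destruct Hr as [l Hl].
  set (P := 2 ^ k) in *.
  assert (HP : 0 < P) by (pose proof (Nat.pow_nonzero 2 k); unfold P; lia).
  change ((0, P) = consume N P (0, P) (true :: l)) in Hl.
  pose proof (consume_low N P (true :: l) 0 P) as Hlow.
  pose proof (consume_balanced N P (true :: l) 0 P) as Hhigh.
  rewrite <- Hl in Hlow, Hhigh. cbn [fst snd] in *. specialize (Hhigh HP).
  unfold balanced in Hhigh.
  set (ys := true :: l) in *. set (xs := product_bits N 0 ys) in *.
  (* N is odd and Y starts with 1, so X starts with 1 too. *)
  assert (Hxs : exists l', xs = true :: l').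
  { unfold xs, ys. cbn [product_bits Nat.b2n]. rewrite Nat.add_0_l, Nat.mul_1_l, Hodd. eauto. }
  destruct Hxs as [l' Hxs].
  assert (Hlen : length xs = length ys) by apply length_product_bits.
  (* The vanishing final carry equates the low halves of A and N B; [Hhigh], which says P *
     [msb_val xs] = N * [msb_val ys], equates the high halves. *)
  exists (lsb_val (xs ++ repeat false k ++ rev xs)), (lsb_val (ys ++ rev ys)).
  split; [|split].
  - rewrite Hxs. apply palindromic_lsb_val.
    change (rev ((true :: l') ++ repeat false k ++ rev (true :: l'))
            = (true :: l') ++ repeat false k ++ rev (true :: l')).
    rewrite !rev_app_distr, rev_involutive, rev_repeat, <- app_assoc. reflexivity.
  - apply palindromic_lsb_val.
    change (rev (ys ++ rev ys) = ys ++ rev ys). now rewrite rev_app_distr, rev_involutive.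
  - rewrite !lsb_val_app, lsb_val_repeat_false, repeat_length, Hlen.
    fold (msb_val xs) (msb_val ys) P. nia.
Qed.

Lemma palindromic_quotient_loops (N : nat) :
  0 < N -> palindromic_quotient N ->
  Nat.odd N = true /\ exists k, 2 ^ k < 2 * N /\ loops N k.
Proof.
  intros HN (A & B & HA & HB & HAB).
  destruct (palindromic_bits_cons _ HA) as [la Hla].
  destruct (palindromic_bits_cons _ HB) as [lb Hlb].
  apply palindromic_bits in HA, HB. destruct HA as [HA0 HA], HB as [HB0 HB].
  assert (HvA : lsb_val (bits A) = A) by now apply lsb_val_bits_aux.
  assert (HvB : lsb_val (bits B) = B) by now apply lsb_val_bits_aux.
  (* The length difference k is a genuine one because B <= A. *)
  assert (Hlen : length (bits B) <= length (bits A)).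
  { destruct (bits_aux_snoc_true B B) as [l0 Hl0]; [lia|].
    pose proof (lsb_val_lt (bits A)) as HltA. rewrite HvA in HltA.
    assert (HleB : 2 ^ length l0 <= B).
    { rewrite <- HvB at 1. unfold bits. rewrite Hl0, lsb_val_app. cbn [lsb_val Nat.b2n]. lia. }
    unfold bits at 1. rewrite Hl0, length_app. cbn [length].
    assert (2 ^ length l0 < 2 ^ length (bits A)) by nia.
    apply Nat.pow_lt_mono_r_iff in H; lia. }
  set (k := length (bits A) - length (bits B)).
  set (P := 2 ^ k).
  assert (HP : 0 < P) by (pose proof (Nat.pow_nonzero 2 k); unfold P; lia).
  (* Zeros at the high end pad B to the length of A; since B is a palindrome, the reversed padded
     word has value P * B. *)
  set (l := lb ++ repeat false k).
  set (ys := bits B ++ repeat false k).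
  assert (Hys : ys = true :: l) by (unfold ys, l; now rewrite Hlb).
  assert (Hlys : length ys = length (bits A))
    by (unfold ys; rewrite length_app, repeat_length; unfold k; lia).
  assert (Hvys : lsb_val ys = B)
    by (unfold ys; rewrite lsb_val_app, lsb_val_repeat_false, HvB; lia).
  assert (Hmys : msb_val ys = P * B).
  { unfold msb_val, ys. rewrite rev_app_distr, rev_repeat, lsb_val_app, lsb_val_repeat_false,
      repeat_length, HB, HvB. reflexivity. }
  pose proof (consume_low N P ys 0 P) as Hlow.
  pose proof (lsb_val_lt (bits A)) as HltA. rewrite HvA in HltA.
  (* A nonzero carry would make A = N * B at least 2^(length of A). *)
  assert (Hc : fst (consume N P (0, P) ys) = 0).
  { destruct (fst (consume N P (0, P) ys)) as [|c] eqn:E; [reflexivity|].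
    rewrite Hvys, Hlys in Hlow. nia. }
  assert (Hxs : product_bits N 0 ys = bits A).
  { apply lsb_val_inj; [now rewrite length_product_bits|].
    rewrite Hc in Hlow. lia. }
  assert (Hbal : balanced N P 0 P ys P).
  { unfold balanced. rewrite Hxs, Hmys. unfold msb_val. rewrite HA, HvA. nia. }
  assert (Hodd : Nat.odd N = true).
  { rewrite Hys, Hla in Hxs. cbn [product_bits Nat.b2n] in Hxs.
    rewrite Nat.add_0_l, Nat.mul_1_l in Hxs. congruence. }
  split; [assumption|]. exists k. fold P.
  assert (Hfin : consume N P (0, P) ys = (0, P)).
  { rewrite (surjective_pairing (consume N P (0, P) ys)), Hc.
    now rewrite (balanced_consume N P ys 0 P P HP Hbal). }
  rewrite Hys in Hbal, Hfin. apply balanced_next in Hbal; [|assumption].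
  pose proof (balanced_bound _ _ _ _ _ HN Hbal) as Hg.
  (* The first digit 1 leads to g = 2P - N, which must be below N + P. *)
  assert (HP2 : P < 2 * N).
  { unfold next in Hg. cbn [fst snd Nat.b2n] in Hg.
    rewrite Nat.add_0_l, Nat.mul_1_l, Hodd in Hg. lia. }
  split; [assumption|].
  destruct (balanced_reachable N P (3 * N) (next N P true (0, P)) l 0 (next N P true (0, P)))
    as [n Hn]; try assumption; [lia|apply reachable_start; lia|].
  exists n. fold P.
  change (consume N P (next N P true (0, P)) l) with (consume N P (0, P) (true :: l)) in Hn.
  now rewrite Hfin in Hn.
Qed.

(** * Saturation *)

Fixpoint loop {X : Type} (n : nat) (F : nat -> X -> X) (x : X) : X :=
  match n with
  | 0 => x
  | S k => F k (loop k F x)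
  end.

Lemma loop_invariant {X : Type} (I : X -> Prop) (n : nat) (F : nat -> X -> X) (x : X) :
  (forall k y, k < n -> I y -> I (F k y)) -> I x -> I (loop n F x).
Proof.
  intros HF Hx. induction n as [|n IH]; cbn [loop]; [assumption|].
  apply HF; [lia|]. apply IH. intros k y Hk. apply HF. lia.
Qed.

(** Isolates the one useful iteration k: I survives until it, J survives after it. *)
Lemma loop_establish {X : Type} (I J : X -> Prop) (n k : nat) (F : nat -> X -> X) (x : X) :
  (forall i y, I y -> I (F i y)) -> (forall i y, J y -> J (F i y)) ->
  (forall y, I y -> J (F k y)) -> k < n -> I x -> J (loop n F x).
Proof.
  intros HI HJ HIJ. induction n as [|n IH]; intros Hk Hx; [lia|]. cbn [loop].
  destruct (Nat.eq_dec k n) as [->|Hne].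
  - apply HIJ. apply loop_invariant; auto.
  - apply HJ, IH; [lia|assumption].
Qed.

Section Search.

Variables N P W : nat.

Hypothesis N_pos : 0 < N.

Lemma fst_next_lt (b : bool) (x : nat * nat) : fst x < N -> fst (next N P b x) < N.
Proof.
  intros Hx. unfold next. cbn [fst]. rewrite Nat.div2_div.
  apply Nat.Div0.div_lt_upper_bound. destruct b; cbn [Nat.b2n]; lia.
Qed.

(** A walk recorded as the list of its states, latest first, so that it can be cut at a
    repetition. *)
Inductive chain (x0 : nat * nat) : list (nat * nat) -> Prop :=
| chain_start : snd x0 < W -> chain x0 [x0]
| chain_next b y l : chain x0 (y :: l) -> snd (next N P b y) < W ->
    chain x0 (next N P b y :: y :: l).

Lemma chain_suffix (x0 x : nat * nat) (l l' : list (nat * nat)) :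
  chain x0 (l ++ x :: l') -> chain x0 (x :: l').
Proof.
  induction l as [|y l IH]; intros H; [assumption|]. apply IH.
  inversion H as [? E|? ? ? H']; subst.
  - destruct l; discriminate.
  - assumption.
Qed.

Lemma reachable_chain (x0 x : nat * nat) (n : nat) :
  reachable N P W x0 n x -> exists l, NoDup (x :: l) /\ chain x0 (x :: l).
Proof.
  induction 1 as [Hx|n x b _ [l [Hnd Hc]] Hx].
  - exists []. split; [repeat constructor; intros []|now constructor].
  - assert (eq_dec : forall y z : nat * nat, {y = z} + {y <> z})
      by (decide equality; apply Nat.eq_dec).
    destruct (in_dec eq_dec (next N P b x) (x :: l)) as [Hin|Hnin].
    (* A revisited state: go back to its earlier occurrence and drop the detour [l1]. *)
    + apply in_split in Hin. destruct Hin as (l1 & l2 & E). exists l2. rewrite E in *.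
      split; [now apply NoDup_app_remove_l in Hnd|now apply chain_suffix in Hc].
    + exists (x :: l). split; constructor; assumption.
Qed.

Lemma chain_reachable (x0 : nat * nat) (l : list (nat * nat)) :
  chain x0 l -> forall x l', l = x :: l' -> reachable N P W x0 (length l') x.
Proof.
  induction 1 as [Hx|b y l _ IH Hy]; intros x l' [= <- <-];
    [now constructor|]. cbn [length]. constructor; [now apply IH|assumption].
Qed.

Lemma chain_range (x0 : nat * nat) (l : list (nat * nat)) :
  fst x0 < N -> chain x0 l -> Forall (fun x => fst x < N /\ snd x < W) l.
Proof.
  intros H0. induction 1 as [Hx|b y l _ IH Hy]; [repeat constructor; assumption|].
  constructor; [|assumption]. split; [|assumption]. apply fst_next_lt.
  now apply Forall_inv in IH.
Qed.

(** Pigeonhole: a walk without repetition lives in a grid of N * W states. *)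
Lemma reachable_short (x0 x : nat * nat) (n : nat) :
  fst x0 < N -> reachable N P W x0 n x -> exists n', n' <= N * W /\ reachable N P W x0 n' x.
Proof.
  intros H0 Hr. apply reachable_chain in Hr. destruct Hr as (l & Hnd & Hc).
  exists (length l). split; [|now apply (chain_reachable _ _ Hc)].
  apply chain_range in Hc; [|assumption].
  assert (Hincl : incl (x :: l) (list_prod (seq 0 N) (seq 0 W))).
  { intros [c g] Hin. rewrite Forall_forall in Hc. apply Hc in Hin.
    apply in_prod; apply in_seq; cbn [fst snd] in Hin; lia. }
  apply NoDup_incl_length in Hincl; [|assumption].
  rewrite length_prod, !length_seq in Hincl. cbn [length] in Hincl. lia.
Qed.

(* State (c, g) occupies entry c * W + g, and is marked when this entry is at
   least P.  The shifts P are tried in increasing order, so marks left by smaller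
   shifts do not count and the table is never cleared. *)
Definition relax (b : bool) (c g : nat) (f : memory) : memory :=
  let y := next N P b (c, g) in
  if snd y <? W then upd f (fst y * W + snd y) P else f.

Definition visit (c g : nat) (f : memory) : memory :=
  if f (c * W + g) <? P then f else relax true c g (relax false c g f).

Definition sweep (f : memory) : memory := loop N (fun c => loop W (visit c)) f.

(* N * W rounds suffice because a shortest walk repeats no state. *)
Definition search (f : memory) : memory :=
  loop (N * W) (fun _ => sweep) (relax true 0 P f).

Definition marked (f : memory) (x : nat * nat) : Prop := P <= f (fst x * W + snd x).

Lemma upd_same (f : memory) (i v : nat) : upd f i v i = v.
Proof. unfold upd. now rewrite Nat.eqb_refl. Qed.

Lemma relax_le (b : bool) (c g : nat) (f : memory) (i : nat) :
  P <= f i -> P <= relax b c g f i.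
Proof.
  intros H. unfold relax. destruct (_ <? _); [|assumption].
  unfold upd. destruct (_ =? _); [reflexivity|assumption].
Qed.

Lemma relax_marked (b : bool) (c g : nat) (f : memory) :
  snd (next N P b (c, g)) < W -> marked (relax b c g f) (next N P b (c, g)).
Proof.
  intros H. unfold marked, relax. apply Nat.ltb_lt in H. rewrite H, upd_same. reflexivity.
Qed.

Lemma visit_le (c g : nat) (f : memory) (i : nat) : P <= f i -> P <= visit c g f i.
Proof. intros H. unfold visit. destruct (_ <? _); [assumption|now do 2 apply relax_le]. Qed.

Lemma visit_marked (b : bool) (c g : nat) (f : memory) :
  marked f (c, g) -> snd (next N P b (c, g)) < W -> marked (visit c g f) (next N P b (c, g)).
Proof.
  intros Hf Hb. unfold visit. apply Nat.ltb_ge in Hf. cbn [fst snd] in Hf. rewrite Hf.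
  destruct b; [now apply relax_marked|]. now apply relax_le, relax_marked.
Qed.

Lemma sweep_le (f : memory) (i : nat) : P <= f i -> P <= sweep f i.
Proof.
  intros H. unfold sweep. apply (loop_invariant (fun h : memory => P <= h i)); [|assumption].
  intros c h _ Hh. apply (loop_invariant (fun h : memory => P <= h i)); [|assumption].
  intros g h' _. apply visit_le.
Qed.

(** The mark of x persists until the sweep visits x, which then marks its successor for good. *)
Lemma sweep_marked (b : bool) (x : nat * nat) (f : memory) :
  fst x < N -> snd x < W -> marked f x -> snd (next N P b x) < W ->
  marked (sweep f) (next N P b x).
Proof.
  destruct x as [c g]. intros Hc Hg Hf Hb. unfold sweep.
  assert (Hmono : forall z k k' h, marked h z -> marked (visit k k' h) z)
    by (intros z k k' h; apply visit_le).
  apply (loop_establish (fun h => marked h (c, g)) (fun h => marked h (next N P b (c, g))) _ c);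
    try assumption.
  1, 2: intros k h Hh; apply loop_invariant; auto.
  intros h Hh.
  apply (loop_establish (fun h => marked h (c, g)) (fun h => marked h (next N P b (c, g))) _ g);
    auto.
  intros h' Hh'. now apply visit_marked.
Qed.

Lemma reachable_range (x0 x : nat * nat) (n : nat) :
  fst x0 < N -> reachable N P W x0 n x -> fst x < N /\ snd x < W.
Proof.
  intros H0. induction 1 as [Hx|n x b _ IH Hx]; [now split|].
  split; [now apply fst_next_lt|assumption].
Qed.

Let x0 := next N P true (0, P).

(** Each sweep extends all marked walks by an edge, and marks survive further sweeps. *)
Lemma sweeps_complete (n r : nat) (f : memory) (x : nat * nat) :
  reachable N P W x0 n x -> n <= r ->
  marked (loop r (fun _ => sweep) (relax true 0 P f)) x.
Proof.
  assert (H0 : fst x0 < N) by (apply fst_next_lt; assumption).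
  intros H; revert r. induction H as [Hx|n x b Hr IH Hx]; intros r Hn.
  - apply (loop_invariant (fun h => marked h x0)); [|now apply relax_marked].
    intros k h _. apply sweep_le.
  - destruct r as [|r]; [lia|]. cbn [loop].
    apply reachable_range in Hr; [|assumption].
    apply sweep_marked; [tauto|tauto| |assumption]. apply IH. lia.
Qed.

(** The bound by P makes being marked the same as holding exactly P. *)
Definition sound (f : memory) : Prop :=
  forall i, f i <= P /\
    (f i = P -> exists n c g, reachable N P W x0 n (c, g) /\ i = c * W + g).

Lemma relax_sound (b : bool) (c g : nat) (f : memory) :
  (snd (next N P b (c, g)) < W -> exists n, reachable N P W x0 n (next N P b (c, g))) ->
  sound f -> sound (relax b c g f).
Proof.
  intros Hr Hf. unfold relax. destruct (Nat.ltb_spec (snd (next N P b (c, g))) W) as [Hlt|_];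
    [|assumption].
  intros i. unfold upd. destruct (Nat.eqb_spec i (fst (next N P b (c, g)) * W + snd (next N P b (c, g))))
    as [->|_]; [|apply Hf].
  split; [reflexivity|]. intros _. destruct (Hr Hlt) as [n Hn].
  rewrite (surjective_pairing (next N P b (c, g))) in Hn. eauto.
Qed.

Lemma visit_sound (c g : nat) (f : memory) : g < W -> sound f -> sound (visit c g f).
Proof.
  intros Hg Hf. unfold visit. destruct (Nat.ltb_spec (f (c * W + g)) P) as [_|HP]; [assumption|].
  assert (Hr : exists n, reachable N P W x0 n (c, g)).
  { destruct (Hf (c * W + g)) as [Hle Hex].
    destruct Hex as (n & c' & g' & Hr & E); [lia|].
    pose proof (reachable_range x0 (c', g') n (fst_next_lt true (0, P) N_pos) Hr) as [_ Hg'].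
    cbn [snd] in Hg'.
    (* As g and g' are below W, the entry determines the state by division with remainder. *)
    rewrite (Nat.mul_comm c), (Nat.mul_comm c') in E.
    apply Nat.div_mod_unique in E; [|assumption|assumption].
    destruct E as [-> ->]. eauto. }
  destruct Hr as [n Hr].
  apply relax_sound; [|apply relax_sound; [|assumption]];
    intros Hlt; exists (S n); now constructor.
Qed.

(** State (0, P) occupies entry P. The bound on all entries lets the next, larger shift start on the
    same table. *)
Lemma search_spec (f : memory) :
  0 < P < W -> (forall i, f i < P) ->
  (forall i, search f i <= P) /\
  (P <= search f P <-> exists n, reachable N P W x0 n (0, P)).
Proof.
  intros HP Hf. assert (Hs : sound (search f)).
  { unfold search. apply loop_invariant.
    - intros _ h _ Hh. unfold sweep. apply loop_invariant; [|assumption].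
      intros c h' _ Hh'. apply loop_invariant; [|assumption].
      intros g h'' Hg. now apply visit_sound.
    - apply relax_sound; [intros Hlt; exists 0; now constructor|].
      intros i. specialize (Hf i). split; lia. }
  split; [intros i; apply Hs|]. split.
  - intros Hm. destruct (Hs P) as [Hle Hex].
    destruct Hex as (n & c & g & Hr & E); [lia|]. exists n.
    pose proof (reachable_range x0 (c, g) n (fst_next_lt true (0, P) N_pos) Hr) as [_ Hg].
    cbn [snd] in Hg.
    assert (c = 0) as -> by nia. rewrite E at 2. assumption.
  - intros [n Hr].
    apply reachable_short in Hr; [|apply (fst_next_lt true (0, P) N_pos)].
    destruct Hr as (n' & Hn' & Hr). now apply (sweeps_complete n' (N * W) f (0, P)) in Hr.
Qed.

End Search.

(** * Structured programs *)

(* [Unless a b c] skips c when register a is below register b, and [DoWhile c a b]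
   repeats c as long as this holds: each needs only one conditional jump, and the
   machine has no unconditional one. *)
Inductive cmd : Type :=
| Ins (i : instr)
| Seq (c1 c2 : cmd)
| Unless (a b : nat) (c : cmd)
| DoWhile (c : cmd) (a b : nat).

Notation "c1 ;; c2" := (Seq c1 c2) (at level 60, right associativity).
Coercion Ins : instr >-> cmd.

(** Jump targets are absolute, so the load address is a parameter. *)
Fixpoint compile (pc : nat) (c : cmd) : program :=
  match c with
  | Ins i => [i]
  | Seq c1 c2 => compile pc c1 ++ compile (pc + length (compile pc c1)) c2
  | Unless a b c' => JumpLt a b (S pc + length (compile (S pc) c')) :: compile (S pc) c'
  | DoWhile c' a b => compile pc c' ++ [JumpLt a b pc]
  end.

(** Big-step semantics with exact running time. A single instruction must fall through in every
    program, which excludes [Halt] and taken jumps. *)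
Inductive exec : cmd -> memory -> nat -> memory -> Prop :=
| exec_ins i m m' :
    (forall p pc, nth_error p pc = Some i -> step p (pc, m) = Next (S pc, m')) ->
    exec (Ins i) m 1 m'
| exec_seq c1 c2 m t1 m1 t2 m2 :
    exec c1 m t1 m1 -> exec c2 m1 t2 m2 -> exec (Seq c1 c2) m (t1 + t2) m2
| exec_skip a b c m : m a < m b -> exec (Unless a b c) m 1 m
| exec_body a b c m t m' : m b <= m a -> exec c m t m' -> exec (Unless a b c) m (1 + t) m'
| exec_stop c a b m t m' :
    exec c m t m' -> m' b <= m' a -> exec (DoWhile c a b) m (t + 1) m'
| exec_again c a b m t m' t' m'' :
    exec c m t m' -> m' a < m' b -> exec (DoWhile c a b) m' t' m'' ->
    exec (DoWhile c a b) m (t + (1 + t')) m''.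

Lemma nth_error_mid (pre post : program) (i : instr) :
  nth_error (pre ++ i :: post) (length pre) = Some i.
Proof. rewrite nth_error_app2, Nat.sub_diag by lia. reflexivity. Qed.

(** Arbitrary surrounding code and leftover time u let the induction treat subcommands in place. *)
Lemma run_exec (c : cmd) (m : memory) (t : nat) (m' : memory) :
  exec c m t m' -> forall (pre post : program) (u : nat),
  let code := compile (length pre) c in
  run (pre ++ code ++ post) (t + u) (length pre, m) =
  run (pre ++ code ++ post) u (length pre + length code, m').
Proof.
  induction 1 as [i m m' Hi|c1 c2 m t1 m1 t2 m2 _ IH1 _ IH2|a b c m Hab|a b c m t m' Hab _ IH
    |c a b m t m' _ IH Hab|c a b m t m' t' m'' _ IH Hab _ IHw]; intros pre post u code.
  - subst code. cbn [compile app length Nat.add run].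
    rewrite Hi by apply nth_error_mid. now rewrite Nat.add_1_r.
  - subst code. cbn [compile].
    specialize (IH1 pre (compile (length pre + length (compile (length pre) c1)) c2 ++ post) (t2 + u)).
    specialize (IH2 (pre ++ compile (length pre) c1) post u).
    cbv zeta in IH1, IH2. rewrite length_app, <- app_assoc in IH2.
    rewrite <- app_assoc, <- Nat.add_assoc, IH1, IH2, length_app. do 2 f_equal. lia.
  - subst code. cbn [compile app Nat.add run step]. rewrite nth_error_mid.
    apply Nat.ltb_lt in Hab. rewrite Hab. cbn [length]. do 2 f_equal. lia.
  - subst code. cbn [compile app Nat.add run step]. rewrite nth_error_mid.
    apply Nat.ltb_ge in Hab. rewrite Hab.
    specialize (IH (pre ++ [JumpLt a b (S (length pre) + length (compile (S (length pre)) c))]) post u).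
    cbv zeta in IH. rewrite length_app, <- app_assoc in IH. cbn [length app] in IH.
    rewrite Nat.add_1_r in IH. cbn [length]. rewrite Nat.add_succ_r. exact IH.
  - subst code. cbn [compile].
    specialize (IH pre (JumpLt a b (length pre) :: post) (1 + u)). cbv zeta in IH.
    rewrite <- app_assoc. cbn [app]. rewrite <- Nat.add_assoc, IH.
    rewrite app_assoc. cbn [Nat.add run step]. rewrite <- length_app, nth_error_mid.
    apply Nat.ltb_ge in Hab. rewrite Hab. rewrite !length_app. cbn [length].
    do 2 f_equal. lia.
  - specialize (IHw pre post u). cbv zeta in IHw. fold code in IHw. rewrite <- IHw.
    subst code. cbn [compile].
    specialize (IH pre (JumpLt a b (length pre) :: post) (1 + (t' + u))). cbv zeta in IH.
    rewrite <- app_assoc. cbn [app].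
    replace (t + (1 + t') + u) with (t + (1 + (t' + u))) by lia. rewrite IH.
    rewrite app_assoc. cbn [Nat.add run step]. rewrite <- length_app at 1. rewrite nth_error_mid.
    apply Nat.ltb_lt in Hab. rewrite Hab. reflexivity.
Qed.

(** * Total correctness with time bounds *)

Definition reaches (c : cmd) (m : memory) (T : nat) (Q : memory -> Prop) : Prop :=
  exists t m', exec c m t m' /\ t <= T /\ Q m'.

Lemma reaches_weaken (c : cmd) (m : memory) (T T' : nat) (Q Q' : memory -> Prop) :
  reaches c m T Q -> T <= T' -> (forall m', Q m' -> Q' m') -> reaches c m T' Q'.
Proof. intros (t & m' & He & Ht & Hm') HT HQ. exists t, m'. repeat split; [assumption|lia|auto]. Qed.

Lemma reaches_seq (c1 c2 : cmd) (m : memory) (T1 T2 : nat) (Q : memory -> Prop) :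
  reaches c1 m T1 (fun m' => reaches c2 m' T2 Q) -> reaches (c1;; c2) m (T1 + T2) Q.
Proof.
  intros (t1 & m1 & He1 & Ht1 & t2 & m2 & He2 & Ht2 & Hm2).
  exists (t1 + t2), m2. repeat split; [eapply exec_seq; eassumption|lia|assumption].
Qed.

Lemma reaches_step (i : instr) (c : cmd) (m : memory) (T : nat) (Q : memory -> Prop) :
  reaches i m 1 (fun m' => reaches c m' T Q) -> reaches (i;; c) m (S T) Q.
Proof. exact (reaches_seq i c m 1 T Q). Qed.

Lemma reaches_unless (a b : nat) (c : cmd) (m : memory) (va vb T : nat) (Q : memory -> Prop) :
  m a = va -> m b = vb ->
  (va < vb -> Q m) -> (vb <= va -> reaches c m T Q) -> reaches (Unless a b c) m (S T) Q.
Proof.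
  intros <- <- Hlt Hge. destruct (Nat.lt_ge_cases (m a) (m b)) as [H|H].
  - exists 1, m. repeat split; [now constructor|lia|auto].
  - destruct (Hge H) as (t & m' & He & Ht & Hm').
    exists (1 + t), m'. repeat split; [now apply exec_body|lia|assumption].
Qed.

(** The body runs exactly n times, at least once, and each run is followed by one jump test. *)
Lemma reaches_do_while (I : nat -> memory -> Prop) (n : nat) (c : cmd) (a b : nat) (m : memory)
    (T : nat) :
  0 < n -> I 0 m ->
  (forall k m, k < n -> I k m ->
     reaches c m T (fun m' => I (S k) m' /\ (m' a < m' b <-> S k < n))) ->
  reaches (DoWhile c a b) m (n * (T + 1)) (I n).
Proof.
  intros Hn H0 Hstep.
  (* Induction on the number S k of runs still to come. *)
  enough (H : forall k j m, S k + j = n -> I j m ->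
                reaches (DoWhile c a b) m (S k * (T + 1)) (I n)).
  { specialize (H (n - 1) 0 m). replace (S (n - 1)) with n in H by lia. apply H; [lia|assumption]. }
  clear m H0. intros k. induction k as [|k IH]; intros j m Hj HI;
    destruct (Hstep j m) as (t & m' & He & Ht & HI' & Hab); try assumption; try lia.
  - replace n with (S j) in * by lia.
    exists (t + 1), m'. repeat split; [apply exec_stop; [assumption|lia]|lia|assumption].
  - destruct (IH (S j) m') as (t' & m'' & He' & Ht' & HI''); [lia|assumption|].
    exists (t + (1 + t')), m''. repeat split; [|lia|assumption].
    apply exec_again with (m' := m'); [assumption|lia|assumption].
Qed.

Lemma reaches_ins (i : instr) (m m' : memory) (Q : memory -> Prop) :
  (forall p pc, nth_error p pc = Some i -> step p (pc, m) = Next (S pc, m')) ->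
  Q m' -> reaches i m 1 Q.
Proof. intros Hi HQ. exists 1, m'. repeat split; [now constructor|lia|assumption]. Qed.

Lemma reaches_const (d v : nat) (m : memory) (Q : memory -> Prop) :
  Q (upd m d v) -> reaches (Const d v) m 1 Q.
Proof. apply reaches_ins. intros p pc Hp. unfold step. now rewrite Hp. Qed.

Lemma reaches_add (d a b : nat) (m : memory) (va vb : nat) (Q : memory -> Prop) :
  m a = va -> m b = vb -> Q (upd m d (va + vb)) -> reaches (Add d a b) m 1 Q.
Proof. intros <- <-. apply reaches_ins. intros p pc Hp. unfold step. now rewrite Hp. Qed.

Lemma reaches_sub (d a b : nat) (m : memory) (va vb : nat) (Q : memory -> Prop) :
  m a = va -> m b = vb -> Q (upd m d (va - vb)) -> reaches (Sub d a b) m 1 Q.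
Proof. intros <- <-. apply reaches_ins. intros p pc Hp. unfold step. now rewrite Hp. Qed.

Lemma reaches_half (d a : nat) (m : memory) (va : nat) (Q : memory -> Prop) :
  m a = va -> Q (upd m d (Nat.div2 va)) -> reaches (Half d a) m 1 Q.
Proof. intros <-. apply reaches_ins. intros p pc Hp. unfold step. now rewrite Hp. Qed.

Lemma reaches_load (d a : nat) (m : memory) (va vv : nat) (Q : memory -> Prop) :
  m a = va -> m va = vv -> Q (upd m d vv) -> reaches (LoadInd d a) m 1 Q.
Proof. intros <- <-. apply reaches_ins. intros p pc Hp. unfold step. now rewrite Hp. Qed.

Lemma reaches_store (a s : nat) (m : memory) (va vs : nat) (Q : memory -> Prop) :
  m a = va -> m s = vs -> Q (upd m va vs) -> reaches (StoreInd a s) m 1 Q.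
Proof. intros <- <-. apply reaches_ins. intros p pc Hp. unfold step. now rewrite Hp. Qed.

(** * The decision program *)

(* The prefix t marks scratch registers.  rCW caches c * W, so table addresses
   are computed without multiplication. *)
Notation rN := 0 (only parsing).
Notation rP := 1 (only parsing).
Notation rW := 2 (only parsing).
Notation rNW := 3 (only parsing).
Notation rC := 4 (only parsing).
Notation rCW := 5 (only parsing).
Notation rG := 6 (only parsing).
Notation rRound := 7 (only parsing).
Notation rRes := 8 (only parsing).
Notation r2N := 9 (only parsing).
Notation rOne := 10 (only parsing).
Notation rBase := 11 (only parsing).
Notation rZero := 12 (only parsing).
Notation tS := 13 (only parsing).
Notation tA := 14 (only parsing).
Notation tD := 15 (only parsing).
Notation tE := 16 (only parsing).

Notation table_base := 17 (only parsing).

Definition fetch_prog (b : bool) : cmd :=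
  Add tS rC (if b then rN else rZero);;
  Add tA rCW (if b then rNW else rZero);;
  Add tD rG rG;;
  Sub tD tD (if b then rN else rZero).

(* c * W is updated alongside c: with s = c + b N in tS and s * W in tA, the new
   value is (s * W - W) / 2 for odd s, and s * W / 2 for even s. *)
Definition halve_prog : cmd :=
  Half tE tS;;
  Add tE tE tE;;
  Unless tE tS (Sub tD tD rP;; Add tA tA rW);;
  Sub tA tA rW;;
  Half tA tA.

Definition mark_prog : cmd :=
  Add tE tD rOne;;
  Unless rW tE (Add tA tA tD;; Add tA rBase tA;; StoreInd tA rP).

Definition relax_prog (b : bool) : cmd := fetch_prog b;; halve_prog;; mark_prog.

Definition visit_prog : cmd :=
  Add tA rCW rG;;
  Add tA rBase tA;;
  LoadInd tA tA;;
  Unless tA rP (relax_prog false;; relax_prog true).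

Definition sweep_prog : cmd :=
  Const rC 0;;
  Const rCW 0;;
  DoWhile
    (Const rG 0;;
     DoWhile (visit_prog;; Add rG rG rOne) rG rW;;
     Add rC rC rOne;;
     Add rCW rCW rW)
    rC rN.

Definition search_prog : cmd :=
  Const rC 0;;
  Const rCW 0;;
  Add rG rP rZero;;
  relax_prog true;;
  Const rRound 0;;
  DoWhile (sweep_prog;; Add rRound rRound rOne) rRound rNW.

Definition shifts_prog : cmd :=
  Const rP 1;;
  DoWhile
    (search_prog;;
     Add tA rBase rP;;
     LoadInd tA tA;;
     Unless tA rP (Const rRes 1);;
     Add rP rP rP)
    rP r2N.

Definition setup_prog : cmd :=
  Const rOne 1;;
  Const rBase table_base;;
  Add r2N rN rN;;
  Add rW r2N rN;;
  DoWhile (Add rNW rNW rW;; Add rRound rRound rOne) rRound rN.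

(* rRes is 0 or 1, so adding the parity of N and subtracting 1 is a conjunction. *)
Definition parity_prog : cmd :=
  Half tE rN;;
  Add tE tE tE;;
  Sub tE rN tE;;
  Add rRes rRes tE;;
  Sub rRes rRes rOne.

Definition decide_prog : program :=
  compile 0 (setup_prog;; shifts_prog;; parity_prog) ++ [Halt rRes].

(** The invariant tying memory to the abstract search; scratch registers stay unconstrained. *)
Record represents (N W P c g r res : nat) (f m : memory) : Prop := {
  rep_N : m rN = N;
  rep_P : m rP = P;
  rep_W : m rW = W;
  rep_NW : m rNW = N * W;
  rep_C : m rC = c;
  rep_CW : m rCW = c * W;
  rep_G : m rG = g;
  rep_Round : m rRound = r;
  rep_Res : m rRes = res;
  rep_2N : m r2N = N + N;
  rep_One : m rOne = 1;
  rep_Base : m rBase = table_base;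
  rep_Zero : m rZero = 0;
  rep_table : forall i, m (table_base + i) = f i
}.

(** * Symbolic execution of straight-line code *)

Ltac reg :=
  cbn [upd Nat.eqb Nat.add]; first
    [ eassumption
    | match goal with H : forall _, _ = _ |- _ => apply H end
    | reflexivity ].

Ltac ins :=
  lazymatch goal with
  | |- reaches (Ins (Const _ _)) _ _ _ => apply reaches_const
  | |- reaches (Ins (Add _ _ _)) _ _ _ => eapply reaches_add; [reg|reg|]
  | |- reaches (Ins (Sub _ _ _)) _ _ _ => eapply reaches_sub; [reg|reg|]
  | |- reaches (Ins (Half _ _)) _ _ _ => eapply reaches_half; [reg|]
  | |- reaches (Ins (LoadInd _ _)) _ _ _ => eapply reaches_load; [reg|reg|]
  | |- reaches (Ins (StoreInd _ _)) _ _ _ => eapply reaches_store; [reg|reg|]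
  end.

Ltac straight := repeat (cbv beta; first [apply reaches_step; ins | ins]).

(** Restores [represents] after register or table updates, leaving arithmetic fields as goals. *)
Ltac rep :=
  constructor; cbn [upd Nat.eqb Nat.add];
  first
    [ eassumption
    | reflexivity
    | let i := fresh "i" in
      intros i; unfold upd; cbn [Nat.eqb Nat.add]; try destruct (_ =? _);
      first [ reflexivity | match goal with H : forall _, _ = _ |- _ => apply H end ]
    | idtac ].

(** * Correctness and cost of the routines *)

Lemma fetch_prog_spec (N W P c g r res : nat) (f m : memory) (b : bool) :
  represents N W P c g r res f m ->
  reaches (fetch_prog b) m 4 (fun m' => represents N W P c g r res f m' /\
    m' tS = c + Nat.b2n b * N /\ m' tA = (c + Nat.b2n b * N) * W /\
    m' tD = 2 * g - Nat.b2n b * N).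
Proof.
  intros []. destruct b; unfold fetch_prog; straight.
  all: split; [rep|]; cbn [upd Nat.eqb Nat.b2n]; repeat split; lia.
Qed.

Lemma halve_prog_spec (N W P c g r res s d : nat) (f m : memory) :
  represents N W P c g r res f m -> m tS = s -> m tA = s * W -> m tD = d ->
  reaches halve_prog m 7 (fun m' => represents N W P c g r res f m' /\
    m' tA = Nat.div2 s * W /\ m' tD = d - (if Nat.odd s then 0 else P)).
Proof.
  intros [] Hs HA Hd. unfold halve_prog.
  assert (Hdiv := Nat.div2_odd s).
  straight.
  (* [tE], twice the half of s, is below s exactly for odd s. For even s the added W cancels the
     subtraction that follows. *)
  apply (reaches_seq _ _ _ 3 2).
  destruct (Nat.odd s); cbn [Nat.b2n] in Hdiv.
  - eapply reaches_unless; [reg|reg| |lia]. intros _.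
    straight. split; [rep|]. cbn [upd Nat.eqb]. split; [|lia].
    replace (s * W - W) with (2 * (Nat.div2 s * W)) by (rewrite Hdiv at 2; lia). now rewrite Nat.div2_double.
  - eapply reaches_unless; [reg|reg|lia|]. intros _.
    straight. split; [rep|]. cbn [upd Nat.eqb]. split; [|lia].
    replace (s * W + W - W) with (2 * (Nat.div2 s * W)) by (rewrite Hdiv at 2; lia). now rewrite Nat.div2_double.
Qed.

Lemma mark_prog_spec (N W P c g r res h d : nat) (f m : memory) :
  represents N W P c g r res f m -> m tA = h * W -> m tD = d ->
  reaches mark_prog m 5
    (represents N W P c g r res (if d <? W then upd f (h * W + d) P else f)).
Proof.
  intros [] HA Hd. unfold mark_prog. straight.
  (* [tE] holds d + 1, so the test W < d + 1 skips exactly when W <= d. *)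
  eapply reaches_unless; [reg|reg| |]; intros Hlt.
  - replace (d <? W) with false by (symmetry; apply Nat.ltb_ge; lia). rep.
  - replace (d <? W) with true by (symmetry; apply Nat.ltb_lt; lia). straight. rep.
Qed.

Lemma relax_prog_spec (N W P c g r res : nat) (f m : memory) (b : bool) :
  represents N W P c g r res f m ->
  reaches (relax_prog b) m 16 (represents N W P c g r res (relax N P W b c g f)).
Proof.
  intros H. unfold relax_prog.
  apply (reaches_seq _ _ _ 4 12).
  eapply reaches_weaken; [eapply fetch_prog_spec, H|reflexivity|]. cbv beta.
  clear m H. intros m (H & HS & HA & HD).
  apply (reaches_seq _ _ _ 7 5).
  eapply reaches_weaken; [eapply halve_prog_spec; eassumption|reflexivity|]. cbv beta.
  clear m H HS HA HD. intros m (H & HA & HD).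
  now apply mark_prog_spec.
Qed.

(** The cost 36 is 3 for loading the entry, 1 for the test and 16 for each relaxation. *)
Lemma visit_prog_spec (N W P c g r res : nat) (f m : memory) :
  represents N W P c g r res f m ->
  reaches visit_prog m 36 (represents N W P c g r res (visit N P W c g f)).
Proof.
  intros H. pose proof H as []. unfold visit_prog, visit. straight.
  assert (H' : represents N W P c g r res f (upd (upd (upd m tA (c * W + g)) tA
      (table_base + (c * W + g))) tA (f (c * W + g)))) by rep.
  eapply reaches_unless; [reg|reg| |]; intros Hlt.
  - apply Nat.ltb_lt in Hlt. rewrite Hlt. exact H'.
  - apply Nat.ltb_ge in Hlt. rewrite Hlt. apply (reaches_seq _ _ _ 16 16).
    eapply reaches_weaken; [apply relax_prog_spec; exact H'|reflexivity|].
    intros m'. apply relax_prog_spec.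
Qed.


Lemma sweep_prog_spec (N W P c g r res : nat) (f m : memory) :
  0 < N -> 0 < W -> represents N W P c g r res f m ->
  reaches sweep_prog m (50 * (N * W)) (fun m' =>
    exists c' g', represents N W P c' g' r res (sweep N P W f) m').
Proof.
  intros HN HW H. pose proof H as [].
  (* A visit and its increment cost 37; each loop adds one jump per iteration. *)
  eapply reaches_weaken with (T := 2 + N * (S (W * (37 + 1) + 2) + 1)); [|nia|intros m' H'; exact H'].
  unfold sweep_prog. straight.
  match goal with |- reaches _ ?m0 _ _ =>
    assert (H0 : represents N W P 0 g r res f m0) by rep end.
  eapply reaches_weaken; [|reflexivity|].
  - apply (reaches_do_while (fun k m' => exists g',
      represents N W P k g' r res (loop k (fun c => loop W (visit N P W c)) f) m'));
      [assumption|eauto|].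
    clear - HN HW. intros k m Hk [g' H]. pose proof H as []. straight.
    match goal with |- reaches _ ?m0 _ _ =>
      assert (H0 : represents N W P k 0 r res (loop k (fun c => loop W (visit N P W c)) f) m0)
        by rep end.
    apply (reaches_seq _ _ _ (W * (37 + 1)) 2). eapply reaches_weaken; [|reflexivity|].
    + apply (reaches_do_while (fun j m' =>
        represents N W P k j r res
          (loop j (visit N P W k) (loop k (fun c => loop W (visit N P W c)) f)) m'));
        [assumption|assumption|].
      clear - HN HW. intros j m Hj H. apply (reaches_seq _ _ _ 36 1).
      eapply reaches_weaken; [eapply visit_prog_spec, H|reflexivity|].
      clear m H. intros m H. pose proof H as []. straight. split.
      * rep. lia.
      * cbn [upd Nat.eqb]. lia.
    + clear - HN HW Hk. intros m H. pose proof H as []. straight. split.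
      * exists W. rep; lia.
      * cbn [upd Nat.eqb]. lia.
  - intros m' [g' H']. exists N, g'. exact H'.
Qed.

Lemma search_prog_spec (N W P c g r res : nat) (f m : memory) :
  0 < N -> 0 < W -> represents N W P c g r res f m ->
  reaches search_prog m (100 * (N * W) * (N * W)) (fun m' =>
    exists c' g' r', represents N W P c' g' r' res (search N P W f) m').
Proof.
  intros HN HW H. pose proof H as [].
  assert (HNW : 0 < N * W) by nia.
  eapply reaches_weaken with (T := 3 + (16 + S (N * W * (50 * (N * W) + 1 + 1))));
    [|nia|intros m' H'; exact H'].
  unfold search_prog. straight.
  match goal with |- reaches _ ?m0 _ _ =>
    assert (H0 : represents N W P 0 P r res f m0) by (rep; lia) end.
  apply reaches_seq.
  eapply reaches_weaken; [eapply relax_prog_spec, H0|reflexivity|].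
  clear - HN HW HNW. intros m H. pose proof H as []. straight.
  match goal with |- reaches _ ?m0 _ _ =>
    assert (H0 : represents N W P 0 P 0 res (relax N P W true 0 P f) m0) by rep end.
  eapply reaches_weaken; [|reflexivity|].
  - apply (reaches_do_while (fun k m' => exists c' g',
      represents N W P c' g' k res
        (loop k (fun _ => sweep N P W) (relax N P W true 0 P f)) m'));
      [assumption|eauto|].
    clear - HN HW. intros k m Hk (c & g & H). apply reaches_seq.
    eapply reaches_weaken; [eapply sweep_prog_spec, H; assumption|reflexivity|].
    clear - Hk. intros m (c & g & H). pose proof H as []. straight. split.
    + exists c, g. rep. lia.
    + cbn [upd Nat.eqb]. lia.
  - intros m' (c' & g' & H'). exists c', g', (N * W). exact H'.
Qed.

(* The table and the answer after the shifts 2^0, ..., 2^(n-1). *)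
Fixpoint shifts (N W n : nat) : memory * nat :=
  match n with
  | 0 => (fun _ => 0, 0)
  | S k =>
      let f := search N (2 ^ k) W (fst (shifts N W k)) in
      (f, if f (2 ^ k) <? 2 ^ k then snd (shifts N W k) else 1)
  end.

Lemma shifts_prog_spec (N W n : nat) (m : memory) :
  0 < N -> 0 < W -> 0 < n -> (forall k, k < n <-> 2 ^ k < 2 * N) ->
  represents N W 0 0 0 N 0 (fun _ => 0) m ->
  reaches shifts_prog m (200 * (N * W) * (N * W) * n) (fun m' =>
    exists P c g r, represents N W P c g r (snd (shifts N W n)) (fst (shifts N W n)) m').
Proof.
  intros HN HW Hn0 Hn H. pose proof H as [].
  assert (HNW : 0 < N * W) by nia.
  (* The 5 covers reading entry P, updating the answer and doubling P. *)
  eapply reaches_weaken with (T := S (n * (100 * (N * W) * (N * W) + 5 + 1)));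
    [|assert (1 <= N * W * (N * W)) by nia; nia|intros m' H'; exact H'].
  unfold shifts_prog. straight.
  match goal with |- reaches _ ?m0 _ _ =>
    assert (H0 : represents N W (2 ^ 0) 0 0 N 0 (fun _ => 0) m0) by rep end.
  eapply reaches_weaken; [|reflexivity|].
  - apply (reaches_do_while (fun k m' => exists c g r,
      represents N W (2 ^ k) c g r (snd (shifts N W k)) (fst (shifts N W k)) m'));
      [assumption|eauto|].
    clear - HN HW Hn. intros k m Hk (c & g & r & H).
    apply reaches_seq.
    eapply reaches_weaken; [eapply search_prog_spec, H; assumption|reflexivity|].
    clear - Hn Hk. intros m (c & g & r & H). pose proof H as []. straight.
    set (f := search N (2 ^ k) W (fst (shifts N W k))) in *.
    match goal with |- reaches _ ?m0 _ _ =>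
      assert (H0 : represents N W (2 ^ k) c g r (snd (shifts N W k)) f m0) by rep end.
    clear - Hn Hk H0.
    apply (reaches_seq _ _ _ 2 1).
    eapply reaches_weaken with (T := 2)
      (Q := represents N W (2 ^ k) c g r (snd (shifts N W (S k))) f);
      [|reflexivity|].
    + pose proof H0 as [].
      eapply reaches_unless; [reg|reg| |]; intros Hlt; cbn [shifts snd]; fold f.
      * apply Nat.ltb_lt in Hlt. rewrite Hlt. exact H0.
      * apply Nat.ltb_ge in Hlt. rewrite Hlt. straight. rep.
    + clear - Hn Hk. intros m H. pose proof H as []. straight. split.
      * exists c, g, r. cbn [shifts fst]. fold f. rep. rewrite Nat.pow_succ_r'. lia.
      * cbn [upd Nat.eqb]. rewrite Hn, Nat.pow_succ_r'. lia.
  - intros m' (c & g & r & H'). exists (2 ^ n), c, g, r. exact H'.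
Qed.

(** Entries at most 2^n are below the next shift 2^(n+1), so [search_spec] applies again without
    clearing the table. *)
Lemma shifts_spec (N n : nat) :
  0 < N -> (forall k, k < n -> 2 ^ k < 2 * N) ->
  (forall i, fst (shifts N (3 * N) n) i < 2 ^ n) /\
  (snd (shifts N (3 * N) n) = 1 /\ (exists k, k < n /\ loops N k) \/
   snd (shifts N (3 * N) n) = 0 /\ ~ (exists k, k < n /\ loops N k)).
Proof.
  intros HN. induction n as [|n IH]; intros Hn.
  - split; [intros i; cbn; lia|]. right. split; [reflexivity|]. intros (k & Hk & _). lia.
  - destruct IH as [Hf Hres]; [intros k Hk; apply Hn; lia|]. cbn [shifts fst snd].
    destruct (search_spec N (2 ^ n) (3 * N) HN (fst (shifts N (3 * N) n))) as [Hle Hiff].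
    + specialize (Hn n (Nat.lt_succ_diag_r n)). pose proof (Nat.pow_nonzero 2 n). lia.
    + assumption.
    + fold (loops N n) in Hiff. split.
      * intros i. specialize (Hle i). rewrite Nat.pow_succ_r'.
        pose proof (Nat.pow_nonzero 2 n). lia.
      * destruct (Nat.ltb_spec (search N (2 ^ n) (3 * N) (fst (shifts N (3 * N) n)) (2 ^ n)) (2 ^ n))
          as [Hlt|Hge].
        -- destruct Hres as [[E (k & Hk & Hl)]|[E Hno]]; [left|right]; split; try assumption.
           ++ exists k. split; [lia|assumption].
           ++ intros (k & Hk & Hl). destruct (Nat.eq_dec k n) as [->|Hkn].
              ** apply Hiff in Hl. lia.
              ** apply Hno. exists k. split; [lia|assumption].
        -- left. split; [reflexivity|]. exists n. split; [lia|now apply Hiff].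
Qed.

(** The product N * 3N arises by repeated addition, using that all registers but the input start at
    0. *)
Lemma setup_prog_spec (N : nat) :
  0 < N ->
  reaches setup_prog (snd (init N)) (4 + N * (2 + 1))
    (represents N (3 * N) 0 0 0 N 0 (fun _ => 0)).
Proof.
  intros HN. set (m := snd (init N)).
  assert (m rN = N) by reflexivity.
  unfold setup_prog. straight.
  (* rNW is still being computed, so the invariant overrides it by its final value. *)
  match goal with |- reaches _ ?m0 _ _ =>
    assert (H0 : represents N (3 * N) 0 0 0 0 0 (fun _ => 0) (upd m0 rNW (N * (3 * N))))
      by (rep; lia);
    assert (HNW : m0 rNW = 0) by reflexivity end.
  eapply reaches_weaken; [|reflexivity|].
  - apply (reaches_do_while (fun k m' =>
      represents N (3 * N) 0 0 0 k 0 (fun _ => 0) (upd m' rNW (N * (3 * N))) /\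
      m' rNW = k * (3 * N))); [assumption|now split|].
    clear. intros k m _ [[] HNW]. cbn [upd Nat.eqb Nat.add] in *. straight.
    split; [split|].
    + rep. lia.
    + cbn [upd Nat.eqb]. lia.
    + cbn [upd Nat.eqb]. lia.
  - clear. intros m [[] HNW]. cbn [upd Nat.eqb Nat.add] in *. rep.
Qed.

Lemma parity_prog_spec (N W P c g r res : nat) (f m : memory) :
  represents N W P c g r res f m ->
  reaches parity_prog m 5 (fun m' => m' rRes = res + Nat.b2n (Nat.odd N) - 1).
Proof.
  intros []. unfold parity_prog. straight. cbn [upd Nat.eqb].
  pose proof (Nat.div2_odd N). lia.
Qed.

(** * Total running time and correctness *)

Lemma square_le_pow2 (n : nat) : n * n <= 2 * 2 ^ n.
Proof.
  destruct (Nat.le_gt_cases n 2) as [H|H].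
  - destruct n as [|[|[|n]]]; simpl; lia.
  - induction H as [|n H IH]; [simpl; lia|]. rewrite Nat.pow_succ_r'. nia.
Qed.

Lemma decide_prog_spec (N : nat) :
  0 < N -> exists (t n : nat) (b : bool),
    run decide_prog t (init N) = Some b /\ t <= 2000 * (N * N * N * N) * n /\ n * n <= 8 * N /\
    (b = true <-> palindromic_quotient N).
Proof.
  (* The number of shifts 2^k below 2N. *)
  intros HN. set (n := Nat.log2_up (2 * N)).
  assert (Hn : forall k, k < n <-> 2 ^ k < 2 * N).
  { intros k. unfold n. symmetry. apply Nat.log2_up_lt_pow2. lia. }
  assert (Hn0 : 0 < n) by (apply Hn; cbn; lia).
  (* n * n <= 2 * 2^n = 4 * 2^(n-1) < 8N. *)
  assert (HnN : n * n <= 8 * N).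
  { pose proof (square_le_pow2 n).
    assert (2 ^ (n - 1) < 2 * N) by (apply Hn; lia).
    assert (2 ^ n = 2 * 2 ^ (n - 1)) by (rewrite <- Nat.pow_succ_r'; f_equal; clearbody n; lia). lia. }
  assert (Hrun : reaches (setup_prog;; shifts_prog;; parity_prog) (snd (init N))
    ((4 + N * (2 + 1)) + (200 * (N * (3 * N)) * (N * (3 * N)) * n + 5))
    (fun m' => m' rRes = snd (shifts N (3 * N) n) + Nat.b2n (Nat.odd N) - 1)).
  { apply reaches_seq. eapply reaches_weaken; [now apply setup_prog_spec|reflexivity|].
    intros m H. apply reaches_seq.
    eapply reaches_weaken; [apply (shifts_prog_spec N (3 * N) n); try assumption; lia|reflexivity|].
    clear m H. intros m (P & c & g & r & H). eapply parity_prog_spec, H. }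
  destruct Hrun as (t & m & Hexec & Ht & Hm).
  exists (t + 1), n, (negb (m rRes =? 0)). split; [|split; [|split; [assumption|]]].
  - pose proof (run_exec _ _ _ _ Hexec [] [Halt rRes] 1) as Hrun. cbv zeta in Hrun.
    etransitivity; [exact Hrun|]. cbn [length Nat.add run step app].
    now rewrite nth_error_mid.
  (* The shifts cost 1800 N^4 n; the remaining 3N + 10 steps fit into 200 N^4 n. *)
  - assert (N <= N * N) by nia. assert (N * N <= N * N * N * N) by nia.
    assert (N * N * N * N <= N * N * N * N * n) by nia. lia.
  - rewrite negb_true_iff, Nat.eqb_neq, Hm.
    destruct (shifts_spec N n HN) as [_ Hres]; [intros k; apply Hn|].
    split.
    + intros Hnz.
      destruct Hres as [[E (k & _ & Hl)]|[E _]]; rewrite E in Hnz.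
      * apply (loops_palindromic_quotient N k); [|assumption].
        destruct (Nat.odd N); [reflexivity|now contradiction Hnz].
      * destruct (Nat.odd N); now contradiction Hnz.
    + intros Hq. apply palindromic_quotient_loops in Hq; [|assumption].
      destruct Hq as (Hodd & k & Hk & Hl). rewrite Hodd.
      destruct Hres as [[E _]|[_ Hno]]; [rewrite E; cbn; lia|].
      contradiction Hno. exists k. split; [now apply Hn|assumption].
Qed.

(** With n at most the square root of 8N, the bound K N^4 n is of order N^(9/2); squaring keeps this
    in integers. *)
Lemma square_time_bound (K N n t : nat) :
  t <= K * (N * N * N * N) * n -> n * n <= 8 * N -> t * t <= K * K * 8 * N ^ 9.
Proof.
  intros Ht Hn.
  transitivity (K * (N * N * N * N) * n * (K * (N * N * N * N) * n)); [now apply Nat.mul_le_mono|].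
  replace (N ^ 9) with (N * N * N * N * (N * N * N * N) * N) by (simpl; ring).
  set (q := N * N * N * N) in *.
  replace (K * q * n * (K * q * n)) with (K * K * (q * q) * (n * n)) by ring.
  replace (K * K * 8 * (q * q * N)) with (K * K * (q * q) * (8 * N)) by ring.
  now apply Nat.mul_le_mono_l.
Qed.

(* There is a RAM program deciding, for every positive N, whether N = A/B with
   A, B binary palindromes, halting within t steps where t <= C * N^(9/2),
   expressed as t^2 <= C * N^9. *)
Theorem theorem4 :
  exists (prog : program) (C : nat),
    forall N : nat, 0 < N ->
      exists (t : nat) (b : bool),
        run prog t (init N) = Some b /\
        t * t <= C * N ^ 9 /\
        (b = true <-> palindromic_quotient N).
Proof.
  exists decide_prog, (2000 * 2000 * 8). intros N HN.
  destruct (decide_prog_spec N HN) as (t & n & b & Hrun & Ht & Hn & Hb).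
  exists t, b. split; [assumption|]. split; [|assumption].
  exact (square_time_bound 2000 N n t Ht Hn).
Qed.
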